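(* Let the inner supremum below range over all irreducible unitary representations $V$ of all compact groups with $\dim V = N$. Then $$\limsup_{N \to \infty} \ \sup_{\dim V = N} \frac{\mathsf{C}(V)}{\ln N} = 1 .$$
   Context: For a group $H$ with a linear representation $\rho$ on a finite-dimensional complex vector space $V$ and a nonzero subspace $U \leq V$, the group-additive diameter is $$\mathrm{diam}_+^{H}(V,U) = \min\{ m \mid \rho(g_1)\cdot U + \dots + \rho(g_m)\cdot U = V \text{ for some } g_1,\dots,g_m \in H\}.$$ If $H$ acts irreducibly on $V$, the covering ratio of $(V,U)$ is $\mathsf{R}(V,U) = \mathrm{diam}_+^{H}(V,U) / \lceil \dim V/\dim U\rceil$, and the covering complexity of $V$ (with respect to $H$) is $\mathsf{C}(V) = \max_{0 \neq U \leq V} \mathsf{R}(V,U)$. Representations of compact groups are continuous; finite groups count as compact groups. *)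

(* Defs.v *)
From HB Require Import structures.
From mathcomp Require Import all_boot all_order all_algebra.
From mathcomp Require Import sesquilinear complex.
From mathcomp Require Import all_classical all_reals all_analysis.

Set Implicit Arguments.
Unset Strict Implicit.
Unset Printing Implicit Defensive.

Import Order.TTheory GRing.Theory Num.Theory.
Import numFieldNormedType.Exports.

Local Open Scope classical_set_scope.
Local Open Scope ring_scope.

HB.mixin Record isCompactGroup G of Topological G & Group G := {
  mulg_continuous : continuous (fun x : G * G => (x.1 * x.2)%g) ;
  invg_continuous : continuous (fun x : G => (x^-1)%g) ;
  compactG : compact [set: G] ;
  hausdorffG : hausdorff_space G
}.

#[short(type="compactGroupType")]
HB.structure Definition CompactGroup :=
  {G of Topological G & Group G & isCompactGroup G}.

Section Representation.
Context {F : fieldType} {V : vectType F} {H : groupType}.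
Implicit Types (rho : H -> 'End(V)) (U : {vspace V}).

Definition representation rho : Prop :=
  rho 1%g = \1%VF /\ forall g h : H, rho (g * h)%g = (rho g \o rho h)%VF.

Definition irreducible rho : Prop :=
  fullv != 0%VS :> {vspace V} /\
  forall U, (forall g, (rho g @: U <= U)%VS) -> U = 0%VS \/ U = fullv.

Definition covering_numbers rho U : set nat :=
  [set m | exists g : 'I_m -> H, (\sum_(i < m) (rho (g i) @: U))%VS = fullv].

(* The value is only meaningful when some translates of U span V, which always
   holds for U != 0 and irreducible rho: see additive_diamP. *)
Definition additive_diam rho U : nat :=
  get (covering_numbers rho U `&` lbound (covering_numbers rho U)).

End Representation.

Section CoveringComplexity.
Context {R : realType} {V : vectType R[i]} {H : groupType}.
Implicit Types (rho : H -> 'End(V)) (U : {vspace V}).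

Definition covering_ratio rho U : R :=
  (additive_diam rho U)%:R /
  (Num.ceil ((\dim {:V})%:R / (\dim U)%:R : R))%:~R.

Definition covering_ratios rho : set R :=
  [set covering_ratio rho U | U in [set U | U != 0%VS]].

(* The maximum exists for irreducible rho: see covering_complexityP. *)
Definition covering_complexity rho : R :=
  get (covering_ratios rho `&` ubound (covering_ratios rho)).

End CoveringComplexity.

Section UnitaryRepresentation.
Context {R : realType} {V : vectType R[i]} {G : compactGroupType}.

Definition dot_norm (dot : {dot V for Num.conj}) (v : V) : R :=
  Num.sqrt (complex.Re (dot v v)).

(* Continuity is that of every orbit map g |-> rho g v for the norm of V, which
   on a finite-dimensional V amounts to continuity of rho into 'End(V). *)
Definition unitary_representation (dot : {dot V for Num.conj})
    (rho : G -> 'End(V)) : Prop :=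
  [/\ representation rho,
      forall g, isometry dot dot (rho g) &
      forall (v : V) (h : G),
        dot_norm dot (rho g v - rho h v) @[g --> h] --> (0 : R)].

End UnitaryRepresentation.

Section Existence.
Context {F : fieldType} {V : vectType F} {H : groupType}.
Variables (rho : H -> 'End(V)) (U : {vspace V}).
Hypotheses (rhoP : representation rho) (rho_irr : irreducible rho).
Hypothesis U0 : U != 0%VS.

Lemma covering_numbers_le_dim :
  exists2 m, covering_numbers rho U m & (m <= \dim {:V})%N.
Proof.
have H1 k : (exists2 m, covering_numbers rho U m & (m <= k)%N) \/
  exists g : 'I_k -> H, (k <= \dim (\sum_(i < k) (rho (g i) @: U)))%N.
  elim: k => [|k [[m Hm lemk]|[g leg]]].
  - by right; exists (fun=> 1%g).
  - by left; exists m => //; apply: leqW.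
  set W := (\sum_(i < k) _)%VS in leg.
  have [WV|WnV] := eqVneq W fullv.
    by left; exists k => //; exists g.
  have [h hW] : exists h, ~~ (rho h @: U <= W)%VS.
    apply: contrapT => /forallNP sub.
    have {}sub h : (rho h @: U <= W)%VS by apply: contrapT => /negP; exact: sub.
    have [|W0|WV] := rho_irr.2 W.
    - move=> h; rewrite limg_sum; apply/subv_sumP => i _.
      by rewrite -limg_comp -rhoP.2; apply: sub.
    - have := sub 1%g; rewrite rhoP.1 lim1g W0 subv0.
      by rewrite (negbTE U0).
    - by rewrite WV eqxx in WnV.
  right; pose g' (i : 'I_k.+1) := if unlift ord_max i is Some j then g j else h.
  exists g'; rewrite big_ord_recr /=.
  have -> : (\sum_(i < k) (rho (g' (widen_ord (leqnSn k) i)) @: U) = W)%VS.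
    apply: eq_bigr => i _; congr (rho _ @: U)%VS; rewrite /g'.
    have -> : widen_ord (leqnSn k) i = lift ord_max i.
      by apply: val_inj; rewrite /= /bump leqNgt ltn_ord.
    by rewrite liftK.
  rewrite /g' unlift_none; apply: leq_ltn_trans leg _.
  rewrite ltnNge; apply: contra hW => dle.
  have : W == (W + rho h @: U)%VS by rewrite eqEdim addvSl.
  by move=> /eqP ->; apply: addvSr.
have [//|[g leg]] := H1 (\dim {:V}).
exists (\dim {:V}) => //; exists g; apply/eqP.
by rewrite eqEdim subvf.
Qed.

Lemma additive_diamP :
  covering_numbers rho U (additive_diam rho U) /\
  lbound (covering_numbers rho U) (additive_diam rho U).
Proof.
have [m0 Hm0 _] := covering_numbers_le_dim.
have exm : exists m, `[<covering_numbers rho U m>] by exists m0; apply/asboolP.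
apply: (@getPex _ (covering_numbers rho U `&` lbound (covering_numbers rho U))).
case: (ex_minnP exm) => m /asboolP Hm minm; exists m; split => // k Hk.
by apply: minm; apply/asboolP.
Qed.

Lemma additive_diam_le_dim : (additive_diam rho U <= \dim {:V})%N.
Proof.
have [m Hm lem] := covering_numbers_le_dim.
by apply: leq_trans lem; apply: additive_diamP.2.
Qed.

End Existence.

Lemma covering_complexityP (R : realType) (V : vectType R[i]) (H : groupType)
    (rho : H -> 'End(V)) :
  representation rho -> irreducible rho ->
  covering_ratios rho (covering_complexity rho) /\
  ubound (covering_ratios rho) (covering_complexity rho).
Proof.
move=> rhoP rhoI; set N := \dim {:V}.
apply: (@getPex _ (covering_ratios rho `&` ubound (covering_ratios rho))).
pose val (x : 'I_N.+1 * 'I_N.+1) : R := x.1%:R / (Num.ceil (N%:R / x.2%:R : R))%:~R.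
pose P (x : 'I_N.+1 * 'I_N.+1) := `[<exists U : {vspace V},
  [/\ U != 0%VS, additive_diam rho U = x.1 & \dim U = x.2]>].
have PU (U : {vspace V}) : U != 0%VS ->
    exists2 x, P x & val x = covering_ratio rho U.
  move=> U0.
  have aN : (additive_diam rho U < N.+1)%N by rewrite ltnS additive_diam_le_dim.
  have bN : (\dim U < N.+1)%N by rewrite ltnS dimvS ?subvf.
  exists (Ordinal aN, Ordinal bN) => //.
  by apply/asboolP; exists U.
have [x0 Px0 _] := PU _ rhoI.1.
case: (Order.TotalTheory.arg_maxP val Px0) => x /asboolP[U [U0 Ux1 Ux2]] maxx.
exists (val x); split.
  by exists U => //; rewrite /val /covering_ratio Ux1 Ux2.
by move=> _ [W W0 <-]; have [y Py <-] := PU W W0; apply: maxx.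
Qed.

(* Main.v *)
From HB Require Import structures.
Require Import Defs.
From mathcomp Require Import all_boot all_order all_algebra.
From mathcomp Require Import sesquilinear spectral complex.
From mathcomp Require Import all_classical all_reals all_analysis.
From mathcomp Require Import ring lra zify.

(** The limit superior is 1 because of two estimates: C(V) <= ln N + 1 for
    every V of dimension N, and C(V) >= (1 - e) ln N for suitable V of
    arbitrarily large dimension N.

    Upper bound.  Given a subspace U of dimension d and a subspace W already
    covered, some translate gU increases the dimension of W by at least
    d (N - dim W) / N ([translate_escapes]).  Indeed, let P and Q be the
    orthogonal projections onto U and onto the orthogonal complement of W.
    The gain dim (W + gU) - dim W is at least tr (Q g P g^-1), and by Schur's
    lemma the mean of g P g^-1 over the group is (d / N) id.  A greedy choice
    of translates therefore multiplies the codimension by at most 1 - d / N at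
    each step, so it drops below 1 after about (N / d) ln N steps
    ([covering_ratio_le]).

    In place of an invariant measure, [orbit_mxtrace_bound] uses elements of
    nearly minimal norm in a convex hull.  In the set of all matrices obtained
    from the orbit of P by repeated midpoints, a matrix A whose Frobenius norm
    is nearly minimal is nearly fixed by the group: otherwise the midpoint of A
    and of a conjugate of A would be shorter, by the parallelogram law.
    Irreducibility makes the differences g B g^-1 - B span the traceless
    matrices, and tr ((g B g^-1 - B) A) = tr (B (g^-1 A g - A)) is small at
    such an A.  So tr (X A) is close to
    tr X tr P / N for every X, which is all that is used of the mean.

    Lower bound.  The signed shifts of C^N, generated by the diagonal sign
    matrices and by the cyclic shifts, act irreducibly.  For a set S of
    coordinates, the translates of the coordinate subspace of S span C^N if
    and only if the corresponding shifts of S cover the index set.  A random S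
    of density 1/k is not covered by m shifts as long as m is at most about
    (1 - e) k ln N: each point is missed with probability (1 - 1/k)^m, the
    events at points that are far apart are independent, and there are only
    N^m ways to choose the shifts ([hard_set_exists]).  Since
    dim V / dim U <= k, this gives C(V) >= (m + 1) / k
    ([monomial_complexity_ge]); [hard_parameters] chooses k and m. *)

Set Implicit Arguments.
Unset Strict Implicit.
Unset Printing Implicit Defensive.

Import Order.TTheory GRing.Theory Num.Theory.

Local Open Scope ring_scope.

(** * Averaging over an irreducible unitary group *)

Section Averaging.
Local Open Scope sesquilinear_scope.
Context {R : realType} {n : nat} {G : groupType}.
Local Notation C := R[i].
Variable M : G -> 'M[C]_n.
Hypothesis MM : forall g h, M (g * h)%g = M h *m M g.
Hypothesis Mu : forall g, M g \is unitarymx.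
Hypothesis Msc : forall Y, (forall g, M g *m Y = Y *m M g) -> exists a, Y = a%:M.

Definition unitary_conj g (A : 'M[C]_n) := (M g)^t* *m A *m M g.

(** A dense part of the convex hull of the orbit of P; midpoints suffice
    because the parallelogram law only involves them. *)
Inductive midpoint_hull (P : 'M[C]_n) : 'M[C]_n -> Prop :=
| midpoint_hull_orbit g : midpoint_hull P (unitary_conj g P)
| midpoint_hull_mid A B : midpoint_hull P A -> midpoint_hull P B ->
    midpoint_hull P (2^-1 *: (A + B)).

Lemma mxtraceB (A B : 'M[C]_n) : \tr (A - B) = \tr A - \tr B.
Proof. exact: raddfB. Qed.

Lemma unitary_conj_linear g : linear (unitary_conj g).
Proof. by move=> a A B; rewrite /unitary_conj mulmxDr mulmxDl -scalemxAr -scalemxAl. Qed.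

HB.instance Definition _ g := GRing.isLinear.Build C 'M[C]_n 'M[C]_n _
  (unitary_conj g) (unitary_conj_linear g).

Lemma unitary_conjM g h A : unitary_conj h (unitary_conj g A) = unitary_conj (h * g)%g A.
Proof. by rewrite /unitary_conj MM trmx_mul map_mxM !mulmxA. Qed.

Lemma midpoint_hull_conj P g A : midpoint_hull P A -> midpoint_hull P (unitary_conj g A).
Proof.
elim=> [h|B D _ IB _ ID]; first by rewrite unitary_conjM; apply: midpoint_hull_orbit.
by rewrite linearZ linearD; apply: midpoint_hull_mid.
Qed.

Lemma unitary_tK g : M g *m (M g)^t* = 1%:M.
Proof. exact/unitarymxP/Mu. Qed.

Lemma mxtrace_unitary_conj g A : \tr (unitary_conj g A) = \tr A.
Proof. by rewrite /unitary_conj mxtrace_mulC mulmxA unitary_tK mul1mx. Qed.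

Lemma mxtrace_midpoint_hull P A : midpoint_hull P A -> \tr A = \tr P.
Proof.
elim=> [g|B D _ IB _ ID]; first exact: mxtrace_unitary_conj.
by rewrite mxtraceZ mxtraceD IB ID; field.
Qed.

(** The adjoint, for the trace form, of A |-> g^-1 A g - A: this moves the
    near invariance of A to the matrices against which A is tested. *)
Lemma mxtrace_coboundary A B g :
  \tr ((M g *m B *m (M g)^t* - B) *m A) = \tr (B *m (unitary_conj g A - A)).
Proof.
rewrite [in LHS]mulmxBl [in RHS]mulmxBr !mxtraceB; congr (_ - _).
by rewrite /unitary_conj -!mulmxA mxtrace_mulC !mulmxA.
Qed.

(** The square of the Frobenius norm. *)
Definition frobenius (A : 'M[C]_n) : C := \sum_i \sum_j `|A i j| ^+ 2.

Lemma frobenius_ge0 A : 0 <= frobenius A.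
Proof. by apply: sumr_ge0 => i _; apply: sumr_ge0 => j _; apply: exprn_ge0. Qed.

Lemma frobenius_entry (A : 'M[C]_n) i j : `|A i j| ^+ 2 <= frobenius A.
Proof.
rewrite /frobenius (bigD1 i)//= (bigD1 j)//= -addrA lerDl addr_ge0//.
  by apply: sumr_ge0 => k _; apply: exprn_ge0.
by apply: sumr_ge0 => l _; apply: sumr_ge0 => k _; apply: exprn_ge0.
Qed.

Lemma frobenius_mxtrace A : frobenius A = \tr (A *m A^t*).
Proof.
apply: eq_bigr => i _; rewrite !mxE; apply: eq_bigr => j _.
by rewrite !mxE normCK.
Qed.

Lemma frobenius_unitary_conj g A : frobenius (unitary_conj g A) = frobenius A.
Proof.
rewrite !frobenius_mxtrace -(mxtrace_unitary_conj g (A *m _)) /unitary_conj.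
rewrite !trmx_mul !map_mxM /= trmxCK.
by rewrite !mulmxA -(mulmxA (_ *m A)) unitary_tK mulmx1.
Qed.

Lemma frobeniusZ a A : frobenius (a *: A) = `|a| ^+ 2 * frobenius A.
Proof.
rewrite /frobenius mulr_sumr; apply: eq_bigr => i _; rewrite mulr_sumr.
by apply: eq_bigr => j _; rewrite !mxE normrM exprMn.
Qed.

Lemma frobenius_parallelogram A B :
  frobenius (A + B) + frobenius (A - B) = 2 * (frobenius A + frobenius B).
Proof.
rewrite /frobenius -!big_split/= mulr_sumr; apply: eq_bigr => i _.
rewrite -!big_split/= mulr_sumr; apply: eq_bigr => j _.
by rewrite !mxE !normCK !rmorphD !rmorphN; ring.
Qed.

Definition near_minimal P d A :=
  midpoint_hull P A /\
  forall B, midpoint_hull P B -> frobenius A <= frobenius B + d.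

Lemma near_minimal_exists P (d : C) : 0 < d -> exists A, near_minimal P d A.
Proof.
move=> d0; pose f A := complex.Re (frobenius A).
have fE A : frobenius A = (f A)%:C%C by rewrite RRe_real// ger0_real ?frobenius_ge0.
have dE : d = (complex.Re d)%:C%C by rewrite RRe_real// ger0_real ?ltW.
pose S := [set f A | A in midpoint_hull P]%classic.
have hS : has_inf S.
  split; first exists (f (unitary_conj 1%g P)), (unitary_conj 1%g P) => //.
    exact: midpoint_hull_orbit.
  exists 0 => _ [A _ <-]; rewrite -lecR -fE; exact: frobenius_ge0.
have d0' : 0 < complex.Re d by rewrite -ltcR -dE.
have [_ [A hA <-] Alt] := inf_adherent d0' hS.
exists A; split=> // B hB; rewrite !fE dE -rmorphD lecR.
apply: le_trans (ltW Alt) _; rewrite lerD2r.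
by apply: ge_inf; [exact: hS.2|exists B].
Qed.

Lemma near_minimal_le P d d' A : d <= d' -> near_minimal P d A -> near_minimal P d' A.
Proof.
move=> dd' [hA mA]; split=> // B hB; apply: le_trans (mA B hB) _.
by rewrite lerD2l.
Qed.

(** The midpoint of A and of its conjugate cannot be shorter than A by more
    than d, and the conjugate is as long as A; so the parallelogram law leaves
    little room for their difference. *)
Lemma near_minimal_inv P d A g :
  near_minimal P d A -> frobenius (unitary_conj g A - A) <= 4 * d.
Proof.
move=> [hA mA]; have := frobenius_parallelogram (unitary_conj g A) A.
rewrite frobenius_unitary_conj => E.
have := mA _ (midpoint_hull_mid (midpoint_hull_conj g hA) hA).
rewrite frobeniusZ normfV normr_nat => H.
have -> : frobenius (unitary_conj g A - A) = 4 * frobenius A - frobenius (unitary_conj g A + A).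
  by apply/eqP; rewrite -subr_eq0; apply/eqP; move/eqP: E; rewrite -subr_eq0 => /eqP <-; ring.
rewrite lerBlDr.
apply: le_trans (_ : 4 * (2^-1 ^+ 2 * frobenius (unitary_conj g A + A) + d) <= _).
  by rewrite ler_pM2l ?ltr0n.
by rewrite le_eqVlt; apply/orP; left; apply/eqP; field.
Qed.

(** This stands for the vanishing of A |-> tr (X A) at the mean of the orbit, the
    mean being approached by minimizing sequences of the hull. *)
Definition small_functional P X := forall e : C, 0 < e ->
  exists2 d, 0 < d & forall A, near_minimal P d A -> `|\tr (X *m A)| < e.

Lemma small_functional_coboundary P B g :
  small_functional P (M g *m B *m (M g)^t* - B).
Proof.
move=> e e0.
(* |tr (B D)| is at most the l^1 norm of B times the largest entry of D; the
   added 1 keeps K positive when B = 0. *)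
pose K : C := 1 + \sum_i \sum_j `|B i j|.
have K0 : 0 < K.
  by rewrite ltr_pwDl// sumr_ge0// => i _; apply: sumr_ge0.
exists ((e / K) ^+ 2 / 4); first by rewrite divr_gt0// exprn_gt0// divr_gt0.
move=> A /(@near_minimal_inv _ _ _ g) mA.
set D := unitary_conj g A - A in mA.
rewrite mxtrace_coboundary -/D.
have Ds i j : `|D i j| <= e / K.
  rewrite -ler_sqr ?nnegrE ?divr_ge0 ?(ltW e0) ?(ltW K0)//.
  apply: le_trans (frobenius_entry D i j) _; apply: le_trans mA _.
  by rewrite mulrC divfK ?pnatr_eq0.
have le1 : `|\tr (B *m D)| <= (\sum_i \sum_j `|B i j|) * (e / K).
  rewrite mulr_suml; apply: le_trans (ler_norm_sum _ _ _) _.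
  apply: ler_sum => i _; rewrite mxE mulr_suml.
  apply: le_trans (ler_norm_sum _ _ _) _.
  by apply: ler_sum => j _; rewrite normrM ler_wpM2l.
apply: le_lt_trans le1 _.
rewrite mulrA ltr_pdivrMr// mulrC ltr_pM2l//.
by rewrite /K ltrDr.
Qed.

Lemma small_functionalD P X Y :
  small_functional P X -> small_functional P Y -> small_functional P (X + Y).
Proof.
move=> nX nY e e0.
have e20 : 0 < e / 2 by rewrite divr_gt0.
have [d d0 dX] := nX _ e20; have [d' d'0 dY] := nY _ e20.
have cdd : d >=< d' by rewrite real_comparable ?ger0_real ?ltW.
exists (Order.min d d'); first by rewrite comparable_lt_min ?d0.
move=> A mA; rewrite mulmxDl linearD /= (splitr e).
apply: le_lt_trans (ler_normD _ _) _; apply: ltrD; [apply: dX|apply: dY].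
  by apply: near_minimal_le mA; rewrite comparable_ge_min ?lexx.
by apply: near_minimal_le mA; rewrite comparable_ge_min ?lexx ?orbT.
Qed.

Lemma small_functionalZ P a X :
  small_functional P X -> small_functional P (a *: X).
Proof.
move=> nX e e0.
have a0 : 0 < 1 + `|a| by rewrite ltr_pwDl.
have [d d0 dX] := nX _ (divr_gt0 e0 a0).
exists d => // A /dX; rewrite -scalemxAl linearZ normrM ltr_pdivlMr// => H.
by apply: le_lt_trans H; rewrite mulrC ler_wpM2l// lerDr.
Qed.

Lemma small_functional0 P : small_functional P 0.
Proof. by move=> e e0; exists 1 => [|A _]; rewrite ?ltr01 ?mul0mx ?mxtrace0 ?normr0. Qed.

Lemma small_functional_span P m (E : 'M[C]_(m, n * n)) (X : 'M[C]_n) :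
  (forall i, small_functional P (vec_mx (row i E))) -> (mxvec X <= E)%MS -> small_functional P X.
Proof.
move=> nE /submxP[D XE]; rewrite -(mxvecK X) XE mulmx_sum_row linear_sum.
apply: (big_ind (small_functional P)) => [|Y Z|i _]; first exact: small_functional0.
  exact: small_functionalD.
by rewrite linearZ /=; apply: small_functionalZ; apply: nE.
Qed.

(** The subspace of small functionals contains every g B g^-1 - B, so a matrix Y
    orthogonal to it for the trace form commutes with the group; by Schur's
    lemma Y is scalar, hence orthogonal to X. *)
Lemma small_functional_traceless P X : \tr X = 0 -> small_functional P X.
Proof.
move=> trX.
(* E is a largest space of matrices, flattened to rows, all of whose elements
   are small functionals; by maximality it contains them all. *)
pose good r := `[< exists E : 'M[C]_(n * n), \rank E = r /\
  (forall i, small_functional P (vec_mx (row i E))) >].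
have ex0 : exists r, good r.
  exists 0%N; apply/asboolP; exists 0; rewrite mxrank0; split=> // i.
  by rewrite row0 linear0; apply: small_functional0.
have bound r : good r -> (r <= n * n)%N.
  by move=> /asboolP[E [<- _]]; apply: rank_leq_row.
have [_ /asboolP[E [<- nE]] maxE] := ex_maxnP ex0 bound.
have inE Y : small_functional P Y -> (mxvec Y <= E)%MS.
  move=> nY; pose E' := <<col_mx E (mxvec Y)>>%MS.
  have : (\rank E' <= \rank E)%N.
    apply: maxE; apply/asboolP; exists E'; split=> // i.
    apply: (@small_functional_span P _ (col_mx E (mxvec Y))).
      move=> k; rewrite -(splitK k); case: (fintype.split k) => l /=.
        by rewrite rowKu.
      by rewrite rowKd ord1 row_id mxvecK.
    by rewrite vec_mxK -(genmxE (col_mx _ _)) row_sub.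
  rewrite genmxE -addsmxE => le_rank.
  have /andP[_] : (E == E + mxvec Y)%MS by rewrite -(geq_leqif (mxrank_leqif_eq (addsmxSl _ _))).
  by apply: submx_trans; apply: addsmxSr.
apply: (small_functional_span nE); rewrite submxE; apply/eqP/rowP => k.
rewrite [RHS]mxE.
(* The columns of the cokernel of E are the linear forms vanishing on E; each
   one is the trace against some matrix Y. *)
pose Y : 'M[C]_n := \matrix_(i, j) cokermx E (mxvec_index j i) k.
have trY Z : (mxvec Z *m cokermx E) 0 k = \tr (Z *m Y).
  rewrite mxE (reindex _ (curry_mxvec_bij _ _)) /= /mxtrace.
  under [RHS]eq_bigr do rewrite mxE.
  by rewrite pair_bigA; apply: eq_bigr => -[i j] _; rewrite /= mxvecE [Y j i]mxE.
have trE Z : small_functional P Z -> \tr (Z *m Y) = 0.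
  by move=> /inE; rewrite submxE -trY => /eqP ->; rewrite mxE.
have [a Ya] : exists a, Y = a%:M.
  apply: Msc => g.
  have YB B : \tr (B *m (unitary_conj g Y - Y)) = 0.
    by rewrite -mxtrace_coboundary; apply/trE/small_functional_coboundary.
  have : unitary_conj g Y - Y = 0.
    set Z := _ - Y; apply/matrixP => i j.
    have := YB (delta_mx j i); rewrite -/Z => H; rewrite [RHS]mxE -[RHS]H.
    by rewrite -(mul_delta_mx (0 : 'I_1)) -mulmxA -rowE mxtrace_mulC -colE trace_mx11 !mxE.
  move=> /eqP; rewrite subr_eq0 => /eqP YE.
  by rewrite -[in LHS]YE /unitary_conj !mulmxA unitary_tK mul1mx.
by rewrite trY Ya mul_mx_scalar linearZ /= trX mulr0.
Qed.

(** If the mean of the orbit of P were available, it would be (tr P / n) id, and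
    pairing it with Q would give the inequality.  Near minimizers of the hull
    replace the mean: the traceless matrix n Q - tr Q id pairs with them to
    almost 0. *)
Lemma orbit_mxtrace_bound (P Q : 'M[C]_n) (r : C) :
  r \is Num.real -> \tr Q * \tr P \is Num.real ->
  (forall g, \tr (Q *m unitary_conj g P) <= r) -> \tr Q * \tr P <= n%:R * r.
Proof.
move=> rr tr_real le_r; have rn : n%:R * r \is Num.real by rewrite realM ?realn.
rewrite real_leNgt//; apply/negP => lt_r.
pose X := n%:R *: Q - (\tr Q)%:M.
have trX : \tr X = 0.
  by rewrite mxtraceB mxtraceZ mxtrace_scalar -[in X in _ - X]mulr_natl subrr.
have [d d0 small] := small_functional_traceless P trX (etrans (subr_gt0 _ _) lt_r).
have [A mA] := near_minimal_exists P d0.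
have {small} := small A mA.
have QA : \tr (Q *m A) <= r.
  have [hA _] := mA; elim: hA => [//|B D _ IB _ ID].
  rewrite -scalemxAr mulmxDr linearZ linearD /=.
  rewrite mulrC ler_pdivrMr ?ltr0n// mulr_natr mulr2n; exact: lerD.
rewrite mulmxBl -scalemxAl mul_scalar_mx mxtraceB !mxtraceZ (mxtrace_midpoint_hull mA.1).
have le_x : n%:R * \tr (Q *m A) <= n%:R * r by rewrite ler_wpM2l ?ler0n.
rewrite ltr0_norm ?subr_lt0 ?(le_lt_trans le_x)// opprB.
by rewrite ltrD2l ltrN2 => /(le_lt_trans le_x); rewrite ltxx.
Qed.

End Averaging.

(** * Orthonormal families and their projections *)

Section Orthonormal.
Local Open Scope sesquilinear_scope.
Context {C : numClosedFieldType} {V : vectType C} (dot : {dot V for Num.conj}).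

Lemma orthonormal_dim S : orthonormal dot S -> \dim <<S>> = size S.
Proof. by move=> /orthonormal_free /eqP. Qed.

Lemma orthonormal_extend (S : seq V) (W : {vspace V}) :
  orthonormal dot S -> (<<S>> <= W)%VS ->
  exists T, orthonormal dot (S ++ T) /\ <<S ++ T>>%VS = W.
Proof.
have [k] := ubnP (\dim W - \dim <<S>>)%N; elim: k S => // k IH S lek oS sSW.
have [WS|nWS] := boolP (W <= <<S>>)%VS.
  by exists [::]; rewrite cats0; split=> //; apply: subv_anti; rewrite sSW.
have /subvPn[v vW vS] := nWS.
have [X XS [Y [vE _ oYS]]] := orthogonal_split dot S v.
have Y0 : Y != 0 by apply: contraNneq vS => Y0; rewrite vE Y0 addr0.
have YW : Y \in W by rewrite -[Y](addKr X) -vE addrC rpredB ?(subvP sSW X XS).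
pose y := (sqrtC (dot Y Y))^-1 *: Y.
have s0 : sqrtC (dot Y Y) != 0 by rewrite sqrt_dnorm_eq0.
have yy : dot y y = 1.
  rewrite dnormZ normfV ger0_norm ?sqrt_dnorm_ge0// -[X in _ * X]sqrtCK -exprMn.
  by rewrite mulVf ?expr1n.
have oy : orthogonal dot S [:: y].
  rewrite orthogonal_sym; apply/orthoPl => s Ss.
  by rewrite linearZl_LR /= (orthoPl oYS s Ss) mulr0.
have oSy : orthonormal dot (rcons S y).
  rewrite -cats1 orthonormal_cat oS oy andbT /=.
  by rewrite /orthonormal /= yy eqxx.
have sSy : (<<rcons S y>> <= W)%VS.
  rewrite -cats1 span_cat span_seq1 subv_add sSW /=.
  by rewrite -memvE memvZ.
have [|T [oT sT]] := IH _ _ oSy sSy; last by exists (y :: T); rewrite -cat_rcons.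
have /dimvS := sSy; rewrite !orthonormal_dim// size_rcons in lek * => ltW.
by rewrite ltnS in lek; apply: leq_trans lek; rewrite subnS ltn_predL subn_gt0.
Qed.

Lemma orthonormal_expand S v : orthonormal dot S -> v \in <<S>>%VS ->
  v = \sum_(s <- S) dot v s *: s.
Proof.
move=> oS vS; have [X XS [Y [vE _ oYS]]] := orthogonal_split dot S v.
have fS := orthonormal_free oS.
have [_ oSS] := orthonormalP oS.
rewrite [LHS](coord_span (X := in_tuple S)) ?in_tupleE// (big_nth 0) big_mkord.
apply: eq_bigr => i _; congr (_ *: _).
rewrite [X in dot X _](coord_span (X := in_tuple S)) ?in_tupleE//.
rewrite linear_sumlz (bigD1 i)//= linearZl_LR /= oSS ?mem_nth// eqxx mulr1.
rewrite big1 ?addr0// => j ji; rewrite linearZl_LR /= oSS ?mem_nth//.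
by rewrite nth_uniq ?free_uniq// (negbTE (ji : (j : nat) != i)) mulr0.
Qed.

Section Coordinates.
Variable e : seq V.
Hypotheses (oe : orthonormal dot e) (fe : <<e>>%VS = fullv).
Local Notation N := (size e).

Definition coor v : 'rV[C]_N := \row_j dot v e`_j.

Lemma coor_is_linear : linear coor.
Proof. by move=> a u v; apply/rowP => j; rewrite !mxE linearPl. Qed.

HB.instance Definition _ := GRing.isLinear.Build C V 'rV[C]_N _ coor coor_is_linear.

Lemma coor_expand v : v = \sum_(j < N) coor v 0 j *: e`_j.
Proof.
rewrite [LHS](orthonormal_expand oe) ?fe ?memvf// (big_nth 0) big_mkord.
by apply: eq_bigr => i _; rewrite mxE.
Qed.

Lemma coor_dot u v : coor u *m (coor v)^t* = (dot u v)%:M.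
Proof.
rewrite [RHS]mx11_scalar [in RHS]mxE mulr1n; apply/matrixP => i j; rewrite !ord1 !mxE mulr1n.
rewrite [in RHS](coor_expand u) linear_sumlz; apply: eq_bigr => k _.
by rewrite !mxE linearZl_LR /= [dot e`_k v]hermC /= mul1r.
Qed.

(** Matrices act on row vectors on the right, so mxlin reverses products. *)
Definition mxlin (f : 'End(V)) : 'M[C]_N := \matrix_i coor (f e`_i).

Lemma coor_lin (f : 'End(V)) v : coor (f v) = coor v *m mxlin f.
Proof.
rewrite {1}(coor_expand v) !linear_sum /= mulmx_sum_row; apply: eq_bigr => k _.
by rewrite rowK !linearZ.
Qed.

Lemma coor_basis (i : 'I_N) : coor e`_i = delta_mx 0 i.
Proof.
have [ue oee] := orthonormalP oe.
by apply/rowP => j; rewrite !mxE oee ?mem_nth// nth_uniq// eqxx /= [j == i]eq_sym.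
Qed.

Lemma coor_mxP A B : (forall v, coor v *m A = coor v *m B) -> A = B :> 'M[C]_N.
Proof. by move=> AB; apply/row_matrixP => i; rewrite !rowE -coor_basis. Qed.

Lemma mxlin_comp (f g : 'End(V)) : mxlin (f \o g)%VF = mxlin g *m mxlin f.
Proof. by apply: coor_mxP => v; rewrite -coor_lin lfunE /= !coor_lin mulmxA. Qed.

Lemma mxlin_unitary (f : 'End(V)) : isometry dot dot f -> mxlin f \is unitarymx.
Proof.
have [ue oee] := orthonormalP oe.
move=> fi; apply/unitarymxP/matrixP => i j.
have : (coor (f e`_i) *m (coor (f e`_j))^t*) 0 0 = (i == j)%:R.
  rewrite coor_dot mxE mulr1n.
  have -> : dot (f e`_i) (f e`_j) = dot e`_i e`_j by exact: fi.
  by rewrite oee ?mem_nth// nth_uniq.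
by rewrite !mxE => <-; apply: eq_bigr => k _; rewrite !mxE.
Qed.

(** The matrix, acting on row vectors, of the orthogonal projection onto the
    span of S, when S is orthonormal. *)
Definition projmx (S : seq V) : 'M[C]_N := \sum_(s <- S) (coor s)^t* *m coor s.

Lemma projmx_cat S T : projmx (S ++ T) = projmx S + projmx T.
Proof. exact: big_cat. Qed.

Lemma mxtrace_projmx S : orthonormal dot S -> \tr (projmx S) = (size S)%:R.
Proof.
move=> /andP[/allP oS _]; rewrite /projmx linear_sum /= -(sum1_size S) natr_sum.
apply: eq_big_seq => s /oS /eqP sE.
by rewrite mxtrace_mulC coor_dot sE mxtrace1.
Qed.

Lemma mxtrace_projmxM S T :
  \tr (projmx S *m projmx T) = \sum_(s <- S) \sum_(t <- T) `|dot s t| ^+ 2.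
Proof.
rewrite /projmx mulmx_suml linear_sum /=; apply: eq_bigr => s _.
rewrite mulmx_sumr linear_sum /=; apply: eq_bigr => t _.
rewrite -mulmxA mxtrace_mulC -!mulmxA coor_dot mulmxA coor_dot -scalar_mxM.
by rewrite mxtrace_scalar mulr1n [dot t s]hermC /= mul1r -normCK.
Qed.

Lemma mxtrace_projmxM_ge0 S T : 0 <= \tr (projmx S *m projmx T).
Proof.
rewrite mxtrace_projmxM; apply: sumr_ge0 => s _; apply: sumr_ge0 => t _.
exact: exprn_ge0.
Qed.

Lemma projmx_full T : orthonormal dot T -> <<T>>%VS = fullv -> projmx T = 1%:M.
Proof.
move=> oT fT; apply: coor_mxP => v; rewrite mulmx1.
rewrite [in RHS](orthonormal_expand oT (v := v)) ?fT ?memvf//.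
rewrite mulmx_sumr linear_sum; apply: eq_bigr => s _.
by rewrite mulmxA coor_dot mul_scalar_mx linearZ.
Qed.

Lemma projmx_map (f : 'End(V)) S :
  projmx (map f S) = (mxlin f)^t* *m projmx S *m mxlin f.
Proof.
rewrite /projmx big_map mulmx_sumr mulmx_suml; apply: eq_bigr => s _.
by rewrite coor_lin trmx_mul map_mxM !mulmxA.
Qed.

End Coordinates.
End Orthonormal.

(** * The logarithmic upper bound *)

(** Schur's lemma: an eigenspace of Y, in coordinates, is an invariant
    subspace. *)
Lemma mxlin_Schur (C : numClosedFieldType) (V : vectType C) (dot : {dot V for Num.conj})
  (H : groupType) (rho : H -> 'End(V)) (e : seq V) :
  irreducible rho -> orthonormal dot e -> <<e>>%VS = fullv ->
  forall Y, (forall g, mxlin dot e (rho g) *m Y = Y *m mxlin dot e (rho g)) ->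
  exists a, Y = a%:M.
Proof.
move=> [V0 irr] oe fe Y cY.
have N0 : (0 < size e)%N.
  by rewrite -(orthonormal_dim oe) fe lt0n dimv_eq0.
have [a /eigenvalueP[v vY v0]] := eigenvalue_closed Y N0.
exists a.
pose phi : 'Hom(V, 'rV[C]_(size e)) := linfun (mulmxr (Y - a%:M) \o coor dot e).
have phiE u : phi u = coor dot e u *m (Y - a%:M) by rewrite lfunE.
have [g|K0|Kfull] := irr (lker phi).
- apply/subvP => _ /memv_imgP[u uK ->]; move: uK; rewrite !memv_ker !phiE => /eqP uK.
  rewrite (coor_lin oe fe) -mulmxA mulmxBr cY mul_mx_scalar -mul_scalar_mx -mulmxBl.
  by rewrite mulmxA uK mul0mx.
- pose u := \sum_j v 0 j *: e`_j.
  have cu : coor dot e u = v.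
    rewrite linear_sum [RHS]row_sum_delta; apply: eq_bigr => j _.
    by rewrite linearZ /= (coor_basis oe).
  have : u \in lker phi.
    by rewrite memv_ker phiE cu mulmxBr vY mul_mx_scalar subrr.
  rewrite K0 memv0 => /eqP u0.
  by rewrite -cu u0 linear0 eqxx in v0.
apply/eqP; rewrite -subr_eq0; apply/eqP; apply: (coor_mxP oe) => u.
rewrite mulmx0 -phiE; apply/eqP; rewrite -memv_ker Kfull; exact: memvf.
Qed.

Section Step.
Context {R : realType} {V : vectType R[i]} (dot : {dot V for Num.conj}).
Context {H : groupType} (rho : H -> 'End(V)).
Hypotheses (rhoP : representation rho) (irr : irreducible rho).
Hypothesis rhoU : forall g, isometry dot dot (rho g).

(** With Q the projection onto the orthogonal complement of W and S an
    orthonormal basis of U, it is enough to bound tr (Q P_gS) by the gain of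
    gU over W for each g; [orbit_mxtrace_bound] then yields the average gain.
    For that bound, split an orthonormal basis of the complement of W into a
    basis T1 of its part inside W + gU, which has as many vectors as the gain,
    and a part T2 orthogonal to gU. *)
Lemma translate_escapes (U W : {vspace V}) : exists g,
  ((\dim {:V} - \dim W) * \dim U <= \dim {:V} * (\dim (W + rho g @: U) - \dim W))%N.
Proof.
pose r g := (\dim (W + rho g @: U) - \dim W)%N.
have [g0 maxg] : exists g0, forall g, (r g <= r g0)%N.
  pose P k := `[< exists g, r g = k >].
  have exP : exists k, P k by exists (r 1%g); apply/asboolP; exists 1%g.
  have bP k : P k -> (k <= \dim {:V})%N.
    by move=> /asboolP[g <-]; rewrite (leq_trans (leq_subr _ _))// dimvS ?subvf.
  have [_ /asboolP[g <-] mx] := ex_maxnP exP bP.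
  by exists g => h; apply: mx; apply/asboolP; exists h.
exists g0; rewrite -/(r g0).
have nil_on : orthonormal dot [::] by [].
have [S [oS sS]] := orthonormal_extend (W := U) nil_on ltac:(by rewrite span_nil sub0v).
have [T0 [oT0 sT0]] := orthonormal_extend (W := W) nil_on ltac:(by rewrite span_nil sub0v).
have [T [oT sT]] := orthonormal_extend (W := fullv) oT0 (subvf _).
rewrite /= in oS sS oT0 sT0.
have [e oe fe] : exists2 e, orthonormal dot e & <<e>>%VS = fullv by exists (T0 ++ T).
have se : size e = \dim {:V} by rewrite -fe (orthonormal_dim oe).
have sizeT : size T = (\dim {:V} - \dim W)%N.
  by rewrite -sT -sT0 (orthonormal_dim oT) (orthonormal_dim oT0) size_cat addKn.
have oT' : orthonormal dot T by move: oT; rewrite orthonormal_cat => /and3P[].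
pose M g := mxlin dot e (rho g).
pose Pr := projmx dot e.
have full1 := projmx_full oe fe.
have MM g h : M (g * h)%g = M h *m M g by rewrite /M rhoP.2 (mxlin_comp oe fe).
have Mu g : M g \is unitarymx by apply: (mxlin_unitary oe fe); apply: rhoU.
have := @orbit_mxtrace_bound _ _ _ _ MM Mu (mxlin_Schur irr oe fe) (Pr S) (Pr T) (r g0)%:R.
rewrite !(mxtrace_projmx oe fe)// => /(_ (realn _ _) (realM (realn _ _) (realn _ _))).
rewrite -!natrM ler_nat -sizeT -se -{1}sS (orthonormal_dim oS); apply => g.
rewrite /unitary_conj -(projmx_map oe fe).
have oS' : orthonormal dot (map (rho g) S).
  have [uS oSS] := orthonormalP oS.
  have dg u v : dot (rho g u) (rho g v) = dot u v by exact: rhoU.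
  have inj : {in S &, injective (rho g)}.
    move=> u v Su Sv uv; apply/eqP; have := dg u v.
    rewrite uv dg !oSS// eqxx; case: (u == v) => // /eqP.
    by rewrite oner_eq0.
  apply/orthonormalP; rewrite map_inj_in_uniq//; split=> // _ _ /mapP[u Su ->] /mapP[v Sv ->].
  by rewrite dg oSS// (inj_in_eq inj).
have sS' : <<map (rho g) S>>%VS = (rho g @: U)%VS by rewrite -limg_span sS.
have sub1 : (<<T0>> <= W + rho g @: U)%VS by rewrite sT0 addvSl.
have [T1 [oT1 sT1]] := orthonormal_extend oT0 sub1.
have [T2 [oT2 sT2]] := orthonormal_extend oT1 (subvf _).
have sizeT1 : size T1 = r g.
  by rewrite /r -sT1 -sT0 (orthonormal_dim oT1) (orthonormal_dim oT0) size_cat addKn.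
(* T0 ++ T and T0 ++ T1 ++ T2 are both orthonormal bases of V, hence the
   complements of T0 in them have the same projection, whatever g is. *)
have PT : Pr T = Pr T1 + Pr T2.
  apply: (addrI (Pr T0)); rewrite addrA -!projmx_cat.
  by rewrite (projmx_full oe fe oT sT) (projmx_full oe fe oT2 sT2).
rewrite PT mulmxDl raddfD /=.
have -> : \tr (Pr T2 *m Pr (map (rho g) S)) = 0.
  rewrite (mxtrace_projmxM oe fe) big_seq big1// => t T2t; rewrite big_seq big1// => s Ss.
  have := oT2; rewrite orthonormal_cat => /and3P[_ _ o12].
  have s1 : s \in <<T0 ++ T1>>%VS by rewrite sT1 (subvP (addvSr _ _))// -sS' memv_span.
  rewrite [dot t s]hermC /= (span_orthogonal o12 s1 (memv_span T2t)).
  by rewrite conjC0 mulr0 normr0 expr0n.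
rewrite addr0.
apply: le_trans (_ : (size T1)%:R <= _); last by rewrite sizeT1 ler_nat.
(* tr (P_T1 P_gS) = tr P_T1 - tr (P_T1 P_S2), with S2 completing gS to an
   orthonormal basis of V. *)
have [S2 [oS2 sS2]] := orthonormal_extend oS' (subvf _).
have oT1' : orthonormal dot T1 by move: oT1; rewrite orthonormal_cat => /and3P[].
rewrite -(mxtrace_projmx oe fe oT1') -[X in _ <= \tr X]mulmx1 -(projmx_full oe fe oS2 sS2).
by rewrite projmx_cat mulmxDr [X in _ <= X]raddfD /= lerDl (mxtrace_projmxM_ge0 oe fe).
Qed.

End Step.

Section UpperBound.
Context {R : realType} {V : vectType R[i]} (dot : {dot V for Num.conj}).
Context {H : groupType} (rho : H -> 'End(V)).
Hypotheses (rhoP : representation rho) (irr : irreducible rho).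
Hypothesis rhoU : forall g, isometry dot dot (rho g).

(** The geometric decay codim <= (1 - d / N)^k N of the greedy choice, cleared
    of denominators. *)
Lemma translates_codim (U : {vspace V}) k : exists g : 'I_k -> H,
  (\dim {:V} ^ k * (\dim {:V} - \dim (\sum_(i < k) (rho (g i) @: U))%VS)
    <= (\dim {:V} - \dim U) ^ k * \dim {:V})%N.
Proof.
elim: k => [|k [g IH]].
  by exists (fun=> 1%g); rewrite !expn0 !mul1n leq_subr.
set N := \dim {:V} in IH *; set W := (\sum_(i < k) _)%VS in IH.
have [h Hh] := translate_escapes rhoP irr rhoU U W.
exists (fun i : 'I_k.+1 => if unlift ord_max i is Some j then g j else h).
rewrite big_ord_recr /= unlift_none.
have -> : (\sum_(i < k) (rho (if unlift ord_max (widen_ord (leqnSn k) i) is Some j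
     then g j else h) @: U))%VS = W.
  apply: eq_bigr => i _.
  have -> : widen_ord (leqnSn k) i = lift ord_max i.
    by apply: val_inj; rewrite /= /bump leqNgt ltn_ord.
  by rewrite liftK.
rewrite -/N in Hh.
have le1 : (\dim W <= \dim (W + rho h @: U))%N by rewrite dimvS ?addvSl.
have le2 : (\dim (W + rho h @: U) <= N)%N by rewrite dimvS ?subvf.
have le3 : (\dim U <= N)%N by rewrite dimvS ?subvf.
have step : (N * (N - \dim (W + rho h @: U)) <= (N - \dim U) * (N - \dim W))%N.
  by move: Hh le1 le2 le3; move: (\dim _) (\dim W) (\dim U) => a b c; nia.
rewrite !expnS -mulnA mulnCA (leq_trans (leq_mul (leqnn _) step))//.
by rewrite mulnCA -mulnA leq_mul2l IH orbT.
Qed.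

Lemma additive_diam_le (U : {vspace V}) k : U != 0%VS ->
  ((\dim {:V} - \dim U) ^ k * \dim {:V} < \dim {:V} ^ k)%N ->
  (additive_diam rho U <= k)%N.
Proof.
move=> U0 lt; have [g Hg] := translates_codim U k.
apply: (additive_diamP rhoP irr U0).2; exists g; apply/eqP.
rewrite eqEdim subvf /= -subn_eq0 -leqn0 -ltnS.
by have := leq_ltn_trans Hg lt; rewrite -[X in (_ < X)%N -> _]muln1 ltn_mul2l => /andP[].
Qed.

(** A codimension below 1 vanishes, and (1 - d / N)^k N < 1 as soon as
    k > (N / d) ln N; the summand 1 pays for rounding k up. *)
Lemma covering_ratio_le (U : {vspace V}) : U != 0%VS ->
  covering_ratio rho U <= ln (\dim {:V})%:R + 1 :> R.
Proof.
move=> U0; rewrite /covering_ratio.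
have d0 : (0 < \dim U)%N by rewrite lt0n dimv_eq0.
have dN : (\dim U <= \dim {:V})%N by rewrite dimvS ?subvf.
have := additive_diam_le U0.
move: (\dim {:V}) (\dim U) (additive_diam rho U) d0 dN => N d a d0 dN diam_le.
have N0 : (0 < N)%N by apply: leq_trans dN.
have NR : 0 < (N%:R : R) by rewrite ltr0n.
have dR : 0 < (d%:R : R) by rewrite ltr0n.
have lnN : 0 <= ln (N%:R : R) by rewrite ln_ge0// ler1n.
set c := N%:R / d%:R : R.
have c1 : 1 <= c by rewrite ler_pdivlMr// mul1r ler_nat.
have c0 : 0 < c by apply: lt_le_trans c1.
have aub : a%:R <= c * ln N%:R + 1 :> R.
  pose k := (Num.truncn (c * ln (N%:R : R))).+1.
  have k_gt : c * ln N%:R < k%:R :> R by apply: truncnS_gt.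
  have k_le : k%:R <= c * ln N%:R + 1 :> R.
    by rewrite -natr1 lerD2r truncn_le// mulr_ge0// ltW.
  apply: le_trans k_le; rewrite ler_nat; apply: diam_le.
  rewrite -(ltr_nat R) natrM !natrX natrB//.
  have -> : (N%:R - d%:R : R) = N%:R * (1 - c^-1).
    by rewrite /c; field; rewrite !gt_eqF.
  rewrite exprMn -mulrA gtr_pMr ?exprn_gt0// -ltr_pdivlMr// mul1r.
  have le_exp : (1 - c^-1) ^+ k <= expR (- c^-1 * k%:R).
    rewrite expRM_natr lerXn2r ?nnegrE ?expR_ge0 ?subr_ge0 ?invf_le1//.
    exact: expR_ge1Dx.
  apply: le_lt_trans le_exp _.
  rewrite -[ltRHS]lnK ?posrE ?invr_gt0// ltr_expR lnV ?posrE// mulNr ltrN2.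
  by rewrite -(ltr_pM2l c0) mulrA divff ?gt_eqF// mul1r.
have cc : c <= (Num.ceil c)%:~R by apply: ceil_ge.
have cc0 : 0 < ((Num.ceil c)%:~R : R) by apply: lt_le_trans cc.
rewrite ler_pdivrMr//; apply: le_trans aub _; rewrite mulrDl mul1r.
by rewrite lerD ?(le_trans c1)// mulrC ler_wpM2l.
Qed.

Lemma covering_complexity_le : covering_complexity rho <= ln (\dim {:V})%:R + 1 :> R.
Proof.
by have [[U U0 <-] _] := covering_complexityP rhoP irr; apply: covering_ratio_le.
Qed.

End UpperBound.

(** * Sets that few translates do not cover *)

Section RandomSubset.
Context {R : realFieldType} {T : finType} (p : R).
Implicit Types (S A : {set T}).

(** The probability of S when each point is selected independently with
    probability p. *)
Definition bernoulli S := \prod_x (if x \in S then p else 1 - p).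

(** The indicator that A and S are disjoint, as a product over points so that
    it factors over disjoint unions of A. *)
Definition avoid A S : R := \prod_(x in A) (x \notin S)%:R.

Lemma sum_bernoulli_prod (a b : T -> R) :
  \sum_S bernoulli S * \prod_x (if x \in S then a x else b x)
    = \prod_x (p * a x + (1 - p) * b x).
Proof.
rewrite bigA_distr; apply: eq_bigr => S _; rewrite -big_split.
by apply: eq_bigr => x _ /=; case: ifP.
Qed.

Lemma sum_bernoulli : \sum_S bernoulli S = 1.
Proof.
transitivity (\sum_S bernoulli S * \prod_x (if x \in S then 1 else 1)).
  by apply: eq_bigr => S _; rewrite big1 ?mulr1// => x _; case: ifP.
by rewrite sum_bernoulli_prod big1// => x _; ring.
Qed.

Lemma sum_bernoulli_card : \sum_S bernoulli S * #|S|%:R = p * #|T|%:R.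
Proof.
under eq_bigr => S _ do rewrite -sum1_card natr_sum big_mkcond mulr_sumr.
rewrite exchange_big /= -sum1_card natr_sum mulr_sumr; apply: eq_bigr => y _.
transitivity (\sum_S bernoulli S *
    \prod_x (if x \in S then 1 else if x == y then 0 else 1)).
  apply: eq_bigr => S _; congr (_ * _); rewrite (bigD1 y)//= eqxx.
  case: ifP => _; last by rewrite mul0r.
  by rewrite mul1r big1// => x /negbTE ->; case: ifP.
rewrite sum_bernoulli_prod (bigD1 y)//= eqxx mulr0 addr0.
by rewrite big1 ?mulr1// => x /negbTE ->; ring.
Qed.

Lemma sum_bernoulli_avoid A : \sum_S bernoulli S * avoid A S = (1 - p) ^+ #|A|.
Proof.
transitivity (\sum_S bernoulli S *
    \prod_x (if x \in S then (x \notin A)%:R else 1)).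
  apply: eq_bigr => S _; congr (_ * _); rewrite /avoid big_mkcond /=.
  by apply: eq_bigr => x _; case: (x \in A); case: (x \in S).
rewrite sum_bernoulli_prod -prodr_const [RHS]big_mkcond /=.
by apply: eq_bigr => x _; case: (x \in A); rewrite /=; ring.
Qed.

(** Independence of the events that S meets B i, for disjoint B i.  Expanding
    both products over subsets J of X reduces it to the avoidance of the union
    of the B i with i in J. *)
Lemma sum_bernoulli_hit (I : finType) (X : {set I}) (B : I -> {set T}) :
  {in X &, forall i j, i != j -> [disjoint B i & B j]} ->
  \sum_S bernoulli S * \prod_(i in X) (1 - avoid (B i) S)
    = \prod_(i in X) (1 - (1 - p) ^+ #|B i|).
Proof.
move=> disjB.
have expand (y : I -> R) : \prod_(i in X) (1 - y i) =
    \sum_(J : {set I}) \prod_i (if i \in J then - ((i \in X)%:R * y i) else 1).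
  rewrite -bigA_distr big_mkcond /=; apply: eq_bigr => i _.
  by case: (i \in X); rewrite ?mul1r ?mul0r ?oppr0 ?add0r// addrC.
rewrite expand; under eq_bigr do rewrite expand mulr_sumr.
rewrite exchange_big /=; apply: eq_bigr => J _.
have [JX|/fintype.subsetPn[j jJ jX]] := boolP (J \subset X); last first.
  rewrite [RHS](bigD1 j)//= jJ (negbTE jX) mul0r oppr0 mul0r big1// => S _.
  by rewrite (bigD1 j)//= jJ (negbTE jX) !mul0r oppr0 mul0r mulr0.
have split_prod (y : I -> R) :
    \prod_i (if i \in J then - ((i \in X)%:R * y i) else 1) =
    (-1) ^+ #|J| * \prod_(i in J) y i.
  rewrite -big_mkcond /= -prodrN; apply: eq_bigr => i /(fintype.subsetP JX) ->.
  by rewrite mul1r.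
pose F i := if i \in J then B i else finset.set0.
have glue (f : T -> R) : \prod_(i in J) \prod_(x in B i) f x
    = \prod_(x in \bigcup_i F i) f x.
  rewrite partition_disjoint_bigcup => [|i j ij]; last first.
    rewrite /F; case: ifP => iJ; last by rewrite -finset.setI_eq0 finset.set0I.
    case: ifP => jJ; last by rewrite -finset.setI_eq0 finset.setI0.
    by apply: disjB => //; apply: (fintype.subsetP JX).
  rewrite big_mkcond; apply: eq_bigr => i _; rewrite /F.
  by case: ifP => // _; rewrite big_set0.
rewrite split_prod; under eq_bigr do rewrite split_prod glue mulrCA.
rewrite -mulr_sumr sum_bernoulli_avoid; congr (_ * _).
under [RHS]eq_bigr do rewrite -prodr_const.
by rewrite glue prodr_const.
Qed.

Hypotheses (p_ge0 : 0 <= p) (p_le1 : p <= 1).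

Lemma bernoulli_ge0 S : 0 <= bernoulli S.
Proof. by apply: prodr_ge0 => x _; case: ifP; rewrite ?subr_ge0. Qed.

Lemma avoidE A S : avoid A S = [disjoint A & S]%:R.
Proof.
rewrite /avoid; have [dAS|] := boolP [disjoint A & S].
  by rewrite big1// => x xA; rewrite (disjointFr dAS xA).
rewrite -finset.setI_eq0 => /finset.set0Pn[x /finset.setIP[xA xS]].
by rewrite (bigD1 x)//= xS mul0r.
Qed.

End RandomSubset.

Section HardSet.
Context {T : finZmodType}.

(** The points of which at least one must lie in S for the translates of S by g
    to cover x. *)
Definition pullbacks m (g : 'I_m -> T) x := [set x - g i | i : 'I_m].

(** Greedy choice: a new point is excluded only by the at most m^2 differences
    g i - g j added to each point chosen before. *)
Lemma separated_points m (g : 'I_m -> T) L : (0 < m)%N -> (L * m ^ 2 <= #|T|)%N ->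
  exists X : {set T}, #|X| = L /\
   {in X &, forall x y, x != y -> [disjoint pullbacks g x & pullbacks g y]}.
Proof.
move=> m0; elim: L => [|L IH] le.
  by exists finset.set0; rewrite cards0; split=> // x y; rewrite inE.
have [|X [cX dX]] := IH; first by rewrite (leq_trans _ le)// leq_mul2r leqnSn orbT.
pose bad := [set u.1 + g u.2.1 - g u.2.2 | u in finset.setX X [set: 'I_m * 'I_m]].
have cbad : (#|bad| < #|T|)%N.
  apply: leq_ltn_trans (leq_imset_card _ _) _.
  rewrite cardsX cX cardsT card_prod card_ord -mulnn in le *.
  by apply: leq_trans le; rewrite ltn_mul2r ltnSn muln_gt0 m0.
have [z zbad] : exists z, z \notin bad.
  apply/existsP; rewrite -negb_forall; apply: contraL cbad => /forallP all_bad.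
  by rewrite -leqNgt subset_leq_card//; apply/fintype.subsetP.
have sep x : x \in X -> [disjoint pullbacks g z & pullbacks g x].
  move=> xX; apply: contraR zbad; rewrite -finset.setI_eq0.
  move=> /finset.set0Pn[y /finset.setIP[]].
  move=> /imsetP[i _ ->] /imsetP[j _ zx].
  apply/imsetP; exists (x, (i, j)); rewrite ?inE ?xX//=.
  by rewrite addrAC -zx subrK.
exists (z |: X); split.
  rewrite cardsU1 cX; case: (boolP (z \in X)) => // zX.
  case/imsetP: zbad; exists (z, (Ordinal m0, Ordinal m0)); rewrite ?inE ?zX//=.
  by rewrite addrK.
move=> x y; rewrite !inE => /predU1P[->|xX] /predU1P[->|yX]; rewrite ?eqxx//.
- by move=> _; apply: sep.
- by move=> _; rewrite disjoint_sym; apply: sep.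
exact: dX.
Qed.

Definition covered m (S : {set T}) (g : 'I_m -> T) :=
  [forall x, exists i, x - g i \in S].

Context {R : realFieldType}.

Lemma sum_bernoulli_covered (p : R) m (g : 'I_m -> T) L :
  0 <= p <= 1 -> (0 < m)%N -> (L * m ^ 2 <= #|T|)%N ->
  \sum_S bernoulli p S * (covered S g)%:R <= (1 - (1 - p) ^+ m) ^+ L.
Proof.
move=> /andP[p0 p1] m0 le.
have [X [cX dX]] := separated_points g m0 le.
have q0 : 0 <= 1 - p by rewrite subr_ge0.
have q1 : 1 - p <= 1 by rewrite gerBl.
apply: le_trans (_ : \sum_S bernoulli p S *
    \prod_(x in X) (1 - avoid (pullbacks g x) S) <= _).
  apply: ler_sum => S _; rewrite ler_wpM2l ?bernoulli_ge0//.
  have [/forallP cov|_] := boolP (covered S g); last first.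
    apply: prodr_ge0 => x _; rewrite avoidE.
    by case: [disjoint _ & _]; rewrite ?subrr ?subr0.
  rewrite big1// => x _; rewrite avoidE; have /existsP[i xi] := cov x.
  suff /negbTE -> : ~~ [disjoint pullbacks g x & S] by rewrite subr0.
  rewrite -finset.setI_eq0; apply/finset.set0Pn; exists (x - g i).
  by rewrite inE xi andbT; apply: imset_f.
rewrite sum_bernoulli_hit// -cX -prodr_const; apply: ler_prod => x _.
have cm : (#|pullbacks g x| <= m)%N.
  by rewrite (leq_trans (leq_imset_card _ _))// cardT size_enum_ord.
rewrite subr_ge0 exprn_ile1//= lerB//.
exact: ler_wiXn2l.
Qed.

(** First moment method.  The expected number of points of S is #|T| / k, and
    the union bound over the #|T| ^ m families g makes it unlikely that some
    family covers T. *)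
Lemma hard_set_exists k m L : (0 < k)%N -> (0 < m)%N -> (L * m ^ 2 <= #|T|)%N ->
  (k * #|T| ^ m.+1)%:R * (1 - (1 - k%:R^-1) ^+ m) ^+ L < 1 :> R ->
  exists S : {set T}, (#|T| <= k * #|S|)%N /\
    forall g : 'I_m -> T, exists x, forall i, x - g i \notin S.
Proof.
move=> k0 m0 leT small; set p : R := k%:R^-1 in small.
have kR : 0 < k%:R :> R by rewrite ltr0n.
have p01 : 0 <= p <= 1 by rewrite invr_ge0 ler0n invf_le1// ler1n.
have [p0 p1] := andP p01.
have T0 : (0 < #|T|)%N by apply/card_gt0P; exists 0.
pose bad (S : {set T}) := [exists g : {ffun 'I_m -> T}, covered S g].
have sum_bad : \sum_S bernoulli p S * (bad S)%:R
    <= #|T|%:R ^+ m * (1 - (1 - p) ^+ m) ^+ L.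
  apply: le_trans (_ : \sum_(g : {ffun 'I_m -> T})
      \sum_S bernoulli p S * (covered S g)%:R <= _).
    rewrite exchange_big /=; apply: ler_sum => S _; rewrite -mulr_sumr.
    rewrite ler_wpM2l ?bernoulli_ge0// -natr_sum ler_nat.
    by case: (boolP (bad S)) => // /existsP[g gS]; rewrite (bigD1 g)//= gS.
  apply: le_trans (_ : \sum_(g : {ffun 'I_m -> T}) (1 - (1 - p) ^+ m) ^+ L <= _).
    by apply: ler_sum => g _; apply: sum_bernoulli_covered.
  by rewrite sumr_const card_ffun card_ord -natrX mulr_natl.
(* The penalty k #|T| makes f nonpositive on the bad sets, while the mean of f
   exceeds #|T| - 1: so one good set S has k #|S| > #|T| - 1, and both sides
   are integers. *)
pose f (S : {set T}) : R := k%:R * #|S|%:R - (k * #|T|)%:R * (bad S)%:R.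
have [S fS] : exists S, #|T|%:R - 1 < f S.
  apply/existsP; apply: contraT; rewrite negb_exists => /forallP fle.
  have : \sum_S bernoulli p S * f S <= #|T|%:R - 1.
    rewrite -[leRHS]mul1r -[X in X * _](sum_bernoulli (T := T) p) mulr_suml.
    apply: ler_sum => S _.
    by rewrite ler_wpM2l ?bernoulli_ge0 ?p0// leNgt fle.
  rewrite leNgt => /negP; case.
  have -> : \sum_S bernoulli p S * f S = #|T|%:R
      - (k * #|T|)%:R * \sum_S bernoulli p S * (bad S)%:R.
    rewrite -[#|T|%:R](mulVKf (negbT (gt_eqF kR))) -/p -sum_bernoulli_card.
    rewrite !mulr_sumr -sumrB.
    by apply: eq_bigr => S _; rewrite /f; ring.
  rewrite ltrD2l ltrN2; apply: le_lt_trans small.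
  rewrite expnS mulnA [in leRHS]natrM -mulrA natrX ler_wpM2l//.
have nbad : ~~ bad S.
  apply: contraTN fS => bS; rewrite -leNgt /f bS mulr1.
  apply: le_trans (_ : 0 <= _); last by rewrite subr_ge0 ler1n.
  by rewrite subr_le0 -natrM ler_nat leq_mul2l max_card orbT.
exists S; split.
  move: fS; rewrite /f (negbTE nbad) mulr0 subr0 ltrBlDr -natrM natr1 ltr_nat.
  by rewrite ltnS.
move=> g; have : ~~ covered S [ffun i => g i].
  by apply: contra nbad => cg; apply/existsP; exists [ffun i => g i].
rewrite negb_forall => /existsP[x]; rewrite negb_exists => /forallP xS.
by exists x => i; have := xS i; rewrite ffunE.
Qed.

End HardSet.

Section ParameterChoice.
Context {R : realType}.

Lemma pow_complement_le (q : R) A t : 0 <= q <= 1 -> 1 <= q * A%:R ->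
  (1 - q) ^+ (A * t) <= (2 ^+ t)^-1.
Proof.
move=> /andP[q0 q1] qA; rewrite exprM -exprVn lerXn2r ?nnegrE ?exprn_ge0 ?subr_ge0//.
apply: le_trans (_ : expR (- q) ^+ A <= _).
  by rewrite lerXn2r ?nnegrE ?subr_ge0 ?expR_ge0//; exact: expR_ge1Dx.
rewrite -expRM_natr mulNr expRN lef_pV2 ?posrE ?expR_gt0//.
apply: le_trans (expR_ge1Dx _); lra.
Qed.

(** As n is at most 2^(5 (m + 1)), the binary logarithm of n^(m + 1) is at most
    5 (m + 1)^2; the exponent 8 (m + 1)^2 leaves room for the factor k. *)
Lemma counting_bound k m A n : (k <= m.+1)%N -> (A <= 2 ^ m.+1)%N ->
  (n = A * (8 * m.+1 ^ 2) * m ^ 2)%N ->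
  (k * n ^ m.+1 < 2 ^ (8 * m.+1 ^ 2))%N.
Proof.
move=> km Am nE; set s := m.+1.
have s2 : (s < 2 ^ s)%N by apply: ltn_expl.
have m2 : (m < 2 ^ m)%N by apply: ltn_expl.
have sm : (s <= 2 ^ m)%N by [].
have n_le : (n <= 2 ^ (5 * s))%N.
  rewrite nE; apply: (@leq_trans (2 ^ s * (2 ^ 3 * 2 ^ (m * 2)) * 2 ^ (m * 2))%N).
    have h1 : (s ^ 2 <= 2 ^ (m * 2))%N by rewrite expnM leq_exp2r.
    have h2 : (m ^ 2 <= 2 ^ (m * 2))%N by rewrite expnM leq_exp2r// ltnW.
    exact: leq_mul (leq_mul Am (leq_mul (leqnn _) h1)) h2.
  by rewrite -!expnD leq_exp2l// /s; lia.
apply: (@leq_ltn_trans (2 ^ s * 2 ^ (5 * s * s))%N).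
  rewrite leq_mul//; first exact: leq_trans km (ltnW s2).
  by rewrite (expnM _ (5 * s)) leq_exp2r.
rewrite -expnD ltn_exp2l// /s; nia.
Qed.

Lemma ln_le_linear (h x : R) : 0 < h -> 0 < x -> ln x <= h * x - ln h.
Proof.
move=> h0 x0; rewrite lerBrDr addrC -lnM ?posrE//.
by rewrite ltW// ln_sublinear// mulr_gt0.
Qed.

(** A point is missed with probability a^-m, where a = k / (k - 1).  So n may be
    taken equal to a^m up to a factor polynomial in m, and then ln n is m ln a
    up to lower order terms.  As k grows, k ln a tends to 1. *)
Lemma hard_parameters (e : R) n0 : 0 < e -> exists k m n L,
  [/\ (0 < k)%N, (0 < m)%N & [/\ (L * m ^ 2 <= n)%N, (n0 <= n)%N, (1 < n)%N,
   (k * n ^ m.+1)%:R * (1 - (1 - k%:R^-1) ^+ m) ^+ L < 1 :> R &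
   (1 - e) * ln n%:R <= m.+1%:R / k%:R :> R]].
Proof.
move=> e0; have [K [K0 Ke]] : exists K, (0 < K)%N /\ 2 <= e * K%:R.
  exists (Num.truncn (2 / e)).+1; split=> //.
  by rewrite mulrC -ler_pdivrMr// ltW// truncnS_gt.
have KR : 0 < K%:R :> R by rewrite ltr0n.
have K1 : 1 <= K%:R :> R by rewrite ler1n.
(* ln (m + 1) <= h (m + 1) - ln h, and h is chosen so that the errors 4 h and
   h (from the constant c) sum to K^-2, where K = k - 1. *)
pose h : R := (5 * K%:R ^+ 2)^-1.
have h0 : 0 < h by rewrite invr_gt0 mulr_gt0 ?exprn_gt0 ?ltr0n.
pose c : R := ln 16 - 4 * ln h.
have [m [m0 Km n0m cm]] : exists m, [/\ (0 < m)%N, (K <= m)%N, (n0 <= m)%N &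
    c <= h * m.+1%:R].
  exists (K + n0 + Num.truncn (`|c| / h))%N; split.
  - by rewrite -addnA ltn_addr.
  - by rewrite -addnA leq_addr.
  - by rewrite addnAC leq_addl.
  rewrite mulrC -ler_pdivrMr//; apply: le_trans (_ : `|c| / h <= _).
    by apply: ler_wpM2r; [rewrite invr_ge0 ltW|exact: ler_norm].
  by apply: le_trans (ltW (truncnS_gt _)) _; rewrite ler_nat ltnS leq_addl.
pose a : R := 1 + K%:R^-1.
have a1 : 1 <= a by rewrite lerDl invr_ge0 ler0n.
have a0 : 0 < a by apply: lt_le_trans a1.
have aV : 1 - K.+1%:R^-1 = a^-1.
  rewrite /a -natr1; field.
  by rewrite gt_eqF// gt_eqF// ltr_wpDr.
have a2 : a <= 2.
  by rewrite /a -[2]/(1 + 1) lerD2l invf_le1.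
have am0 : 0 < a ^+ m by rewrite exprn_gt0.
have [A [A0 Agt Ale]] : exists A, [/\ (0 < A)%N, a ^+ m < A%:R & A%:R <= a ^+ m + 1].
  exists (Num.truncn (a ^+ m)).+1; split=> //; first exact: truncnS_gt.
  by rewrite -natr1 lerD2r truncn_le// ltW.
have [n nE] : exists n, n = (A * (8 * m.+1 ^ 2) * m ^ 2)%N by eexists.
have n_gt : (m < n)%N.
  by rewrite nE -!mulnA (mulnCA m.+1) !(mulnCA _ m.+1) leq_pmulr// !muln_gt0 A0 m0.
exists K.+1, m, n, (A * (8 * m.+1 ^ 2))%N; split=> //; split.
- by rewrite nE.
- exact: leq_trans n0m (ltnW n_gt).
- by apply: leq_trans n_gt.
- have A2 : (A <= 2 ^ m.+1)%N.
    rewrite -(ler_nat R) natrX; apply: le_trans Ale _.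
    rewrite exprS mulr_natl mulr2n lerD//.
      by rewrite lerXn2r ?nnegrE ?(ltW a0).
    by rewrite exprn_ege1// ler1n.
  have := @counting_bound K.+1 m A n Km A2 nE; rewrite -(ltr_nat R) natrX => small.
  rewrite aV exprVn.
  apply: (@le_lt_trans _ _ ((K.+1 * n ^ m.+1)%:R * (2 ^+ (8 * m.+1 ^ 2))^-1)).
    rewrite ler_wpM2l ?ler0n//; apply: pow_complement_le.
      by rewrite invr_ge0 ltW//= invf_le1// exprn_ege1.
    by rewrite mulrC ler_pdivlMr// mul1r ltW.
  by rewrite ltr_pdivrMr ?exprn_gt0// mul1r.
have lnn : ln n%:R <= c + m.+1%:R * (K%:R^-1 + 4 * h).
  have mm : m%:R <= m.+1%:R :> R by rewrite ler_nat.
  have mR : 0 < m.+1%:R :> R by rewrite ltr0n.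
  have n_ub : n%:R <= 16 * a ^+ m * m.+1%:R ^+ 4.
    have -> : 16 * a ^+ m * m.+1%:R ^+ 4 =
      2 * a ^+ m * (8 * m.+1%:R ^+ 2) * m.+1%:R ^+ 2 :> R by ring.
    have -> : n%:R = A%:R * (8 * m.+1%:R ^+ 2) * m%:R ^+ 2 :> R.
      by rewrite nE !natrM; ring.
    apply: ler_pM => //.
    - apply: ler_wpM2r; first by rewrite mulr_ge0.
      apply: le_trans Ale _; rewrite mulr_natl mulr2n lerD2l.
      exact: exprn_ege1.
    - by rewrite lerXn2r ?nnegrE.
  apply: le_trans (_ : ln (16 * a ^+ m * m.+1%:R ^+ 4) <= _).
    by rewrite ler_ln ?posrE ?mulr_gt0 ?exprn_gt0// ltr0n (leq_ltn_trans _ n_gt).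
  rewrite !lnM ?posrE ?mulr_gt0 ?exprn_gt0 ?ltr0n// !lnXn//.
  have lna : ln a <= K%:R^-1 by rewrite le_ln1Dx// (lt_le_trans (ltrN10 R)) ?invr_ge0.
  have lnm := ln_le_linear h0 mR.
  have := ler_wpM2l (ler0n R m) lna.
  have : m%:R * K%:R^-1 <= m.+1%:R * K%:R^-1 :> R by rewrite ler_wpM2r// invr_ge0.
  rewrite -[ln a *+ m]mulr_natl /c; lra.
have [e1|e1] := leP 1 e.
  apply: le_trans (_ : 0 <= _); last by rewrite divr_ge0.
  rewrite mulr_le0_ge0 ?subr_le0// ln_ge0// ler1n.
  by apply: leq_trans n_gt.
apply: le_trans (_ : (1 - e) * (m.+1%:R * (K%:R^-1 + (K%:R ^+ 2)^-1)) <= _).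
  rewrite ler_wpM2l ?subr_ge0 ?(ltW e1)//; apply: le_trans lnn _.
  have -> : (K%:R ^+ 2)^-1 = 5 * h :> R by rewrite /h; field; rewrite gt_eqF.
  lra.
rewrite mulrCA ler_wpM2l// -[leRHS]div1r ler_pdivlMr ?ltr0n// -natr1.
have -> : K%:R^-1 + (K%:R ^+ 2)^-1 = (K%:R + 1) / K%:R ^+ 2 :> R.
  by field; rewrite gt_eqF.
(* It remains that (1 - e) (K + 1)^2 <= K^2, which follows from 2 <= e K. *)
rewrite (_ : _ * _ = (1 - e) * (K%:R + 1) ^+ 2 / K%:R ^+ 2); last by ring.
rewrite ler_pdivrMr ?exprn_gt0// mul1r.
nra.
Qed.
End ParameterChoice.

(** * The monomial representation of the signed shifts *)

Import numFieldNormedType.Exports.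

Local Open Scope classical_set_scope.

(** A sign for each coordinate together with a cyclic shift: a finite group of
    monomial matrices, with the discrete topology. *)
Definition signed_shift n : Type := ({ffun 'I_n.+1 -> bool} * 'I_n.+1)%type.

HB.instance Definition _ n :=
  Finite.copy (signed_shift n) ({ffun 'I_n.+1 -> bool} * 'I_n.+1)%type.

Section Group.
Variable n : nat.
Implicit Types g h : signed_shift n.

(** The composition of the corresponding operators of [monomial_fun]. *)
Definition ss_mul g h : signed_shift n :=
  ([ffun x => g.1 x (+) h.1 (x - g.2)], g.2 + h.2).
Definition ss_one : signed_shift n := ([ffun=> false], 0).
Definition ss_inv g : signed_shift n := ([ffun x => g.1 (x + g.2)], - g.2).

Fact ss_mulA : associative ss_mul.
Proof.
move=> g h k; congr pair; last exact: addrA.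
by apply/ffunP => x; rewrite !ffunE addbA opprD addrA.
Qed.

Fact ss_mul1 : left_id ss_one ss_mul.
Proof.
by case=> s a; congr pair; [apply/ffunP => x; rewrite !ffunE subr0|exact: add0r].
Qed.

Fact ss_mulr1 : right_id ss_one ss_mul.
Proof.
by case=> s a; congr pair; [apply/ffunP => x; rewrite !ffunE addbF|exact: addr0].
Qed.

Fact ss_mulV : left_inverse ss_one ss_inv ss_mul.
Proof.
case=> s a; congr pair; last exact: addNr.
by apply/ffunP => x; rewrite !ffunE /= opprK addbb.
Qed.

Fact ss_mulrV : right_inverse ss_one ss_inv ss_mul.
Proof.
case=> s a; congr pair; last exact: addrN.
by apply/ffunP => x; rewrite !ffunE /= subrK addbb.
Qed.

HB.instance Definition _ := isGroup.Build (signed_shift n)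
  ss_mulA ss_mul1 ss_mulr1 ss_mulV ss_mulrV.

HB.instance Definition _ := hasNbhs.Build (signed_shift n) principal_filter.
HB.instance Definition _ := Discrete_ofNbhs.Build (signed_shift n) erefl.

Fact ss_mul_continuous :
  continuous (fun u : signed_shift n * signed_shift n => (u.1 * u.2)%g).
Proof.
move=> [g h] A /principal_filterP Agh.
exists ([set g], [set h]); first by split; apply: discrete_set1.
by move=> [g' h'] [/= -> ->].
Qed.

Fact ss_inv_continuous : continuous (fun g : signed_shift n => (g^-1)%g).
Proof. by move=> g A /principal_filterP Ag; apply/principal_filterP. Qed.

Fact ss_compact : compact [set: signed_shift n].
Proof. by apply: finite_compact; exact: (@finite_finset (signed_shift n)). Qed.

HB.instance Definition _ := isCompactGroup.Build (signed_shift n)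
  ss_mul_continuous ss_inv_continuous ss_compact discrete_hausdorff.
End Group.

Section Monomial.
Context {R : realType} {n : nat}.
Local Notation C := R[i].
Local Notation V := 'rV[C]_n.+1.
Implicit Types g h : signed_shift n.

Definition monomial_fun g (v : V) : V := \row_x ((-1) ^+ g.1 x * v 0 (x - g.2)).

Fact monomial_fun_linear g : linear (monomial_fun g).
Proof. by move=> a u v; apply/rowP => x; rewrite !mxE mulrDr mulrCA. Qed.

HB.instance Definition _ g := GRing.isLinear.Build C V V _
  (monomial_fun g) (monomial_fun_linear g).

Definition monomial_rep g : 'End(V) := linfun (monomial_fun g).

Lemma monomial_repE g v x : monomial_rep g v 0 x = (-1) ^+ g.1 x * v 0 (x - g.2).
Proof. by rewrite lfunE mxE. Qed.

Lemma monomial_representation : representation monomial_rep.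
Proof.
split=> [|g h]; apply/lfunP => v; apply/rowP => x.
  by rewrite monomial_repE lfunE /= ffunE mul1r subr0.
rewrite comp_lfunE !monomial_repE /= ffunE signr_addb -mulrA; congr (_ * (_ * v 0 _)).
by rewrite opprD addrA.
Qed.

Lemma monomial_unitary : unitary_representation (@dotmx C n.+1) monomial_rep.
Proof.
split; first exact: monomial_representation.
  move=> g u v.
  rewrite [LHS]dotmxE [RHS]dotmxE !mxE (reindex_inj (addIr g.2)) /=.
  apply: eq_bigr => x _; rewrite !mxE !lfunE /= !mxE addrK rmorphM /= rmorph_sign.
  by rewrite mulrACA -expr2 sqrr_sign mul1r.
move=> v h A A0; apply/principal_filterP.
have E : dot_norm (@dotmx C n.+1) (monomial_rep h v - monomial_rep h v) = 0.
  by rewrite subrr /dot_norm linear0l sqrtr0.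
by have := nbhs_singleton A0; rewrite -E.
Qed.

(** Flipping the sign of one coordinate and subtracting isolates that
    coordinate of a vector; the shifts then produce all the basis vectors. *)
Lemma monomial_irreducible : irreducible monomial_rep.
Proof.
split.
  by rewrite -dimv_eq0 dimvf dim_matrix mul1r.
move=> U sU.
have [->|/eqP U0] := pselect (U = 0%VS); first by left.
right; apply/eqP; rewrite eqEsubv subvf /=.
have rhoU g v : v \in U -> monomial_rep g v \in U.
  by move=> vU; apply: (subvP (sU g)); apply: memv_img.
have v0 := vpick0 U; have vU := memv_pick U; set v := vpick U in v0 vU.
have [x vx] : exists x, v 0 x != 0.
  by apply/rV0Pn; rewrite v0.
have eU y : delta_mx 0 y \in U.
  pose g : signed_shift n := ([ffun z => z == x], 0).
  pose h : signed_shift n := ([ffun=> false], y - x).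
  suff exU : delta_mx 0 x \in U.
    suff -> : delta_mx 0 y = monomial_rep h (delta_mx 0 x) by apply: rhoU.
    apply/rowP => z; rewrite monomial_repE !mxE !eqxx /= ffunE mul1r.
    by rewrite opprB addrA subr_eq addrC (inj_eq (addrI _)).
  suff -> : delta_mx 0 x = (2 * v 0 x)^-1 *: (v - monomial_rep g v).
    by rewrite memvZ// memvB// rhoU.
  apply/rowP => z; rewrite !mxE lfunE /= !mxE ?eqxx /= ffunE subr0.
  case: eqP => [->|_]; last by rewrite mul1r subrr mulr0.
  by rewrite mulN1r opprK -mulr2n -[v 0 x *+ 2]mulr_natl mulVf// mulf_neq0// pnatr_eq0.
apply/subvP => w _; rewrite [w]row_sum_delta.
by apply: memv_suml => y _; apply: memvZ.
Qed.
End Monomial.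

Section CoordinateSubspace.
Context {R : realType} {n : nat}.
Local Notation C := R[i].
Local Notation V := 'rV[C]_n.+1.
Local Notation rho := (@monomial_rep R n).
Implicit Types S : {set 'I_n.+1}.

Definition coordinate_basis S : seq V := [seq delta_mx 0 x | x <- enum S].
Definition coordinate_subspace S : {vspace V} := <<coordinate_basis S>>%VS.

Lemma coordinate_basis_orthonormal S : orthonormal (@dotmx C n.+1) (coordinate_basis S).
Proof.
have inj : injective (fun x => delta_mx 0 x : V).
  move=> x y /rowP/(_ x); rewrite !mxE !eqxx /=; case: eqP => // _ /eqP.
  by rewrite oner_eq0.
apply/orthonormalP; rewrite map_inj_uniq// enum_uniq; split=> //.
move=> _ _ /mapP[x _ ->] /mapP[y _ ->]; rewrite [LHS]dotmxE (inj_eq inj).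
rewrite -rowE !mxE !eqxx /=.
by case: (x == y); rewrite ?conjC1 ?conjC0.
Qed.

Lemma dim_coordinate_subspace S : \dim (coordinate_subspace S) = #|S|.
Proof.
by rewrite (orthonormal_dim (coordinate_basis_orthonormal S)) size_map -cardE.
Qed.

Lemma coordinate_subspace_out S u x :
  u \in coordinate_subspace S -> x \notin S -> u 0 x = 0.
Proof.
move=> uS xS; rewrite (orthonormal_expand (coordinate_basis_orthonormal S) uS).
rewrite summxE big_map big_enum big1// => y yS; rewrite !mxE eqxx /=.
by case: eqP => [xy|_]; [rewrite xy yS in xS|rewrite mulr0].
Qed.

(** If the shifts of S miss x, all the translates lie in the hyperplane of
    vectors vanishing at x. *)
Lemma coordinate_translates_proper S m (h : 'I_m -> signed_shift n) x :
  (forall i, x - (h i).2 \notin S) ->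
  (\sum_(i < m) (rho (h i) @: coordinate_subspace S))%VS != fullv.
Proof.
move=> xS; apply/negP => /eqP full.
have : delta_mx 0 x \in (\sum_(i < m) (rho (h i) @: coordinate_subspace S))%VS.
  by rewrite full memvf.
move=> /memv_sumP[w wS /rowP/(_ x)]; rewrite mxE !eqxx summxE big1 => [/eqP|i _].
  by rewrite oner_eq0.
have /memv_imgP[u uS ->] := wS i isT.
by rewrite monomial_repE (coordinate_subspace_out uS (xS i)) mulr0.
Qed.

Lemma monomial_complexity_ge S k m : (0 < k)%N -> (n.+1 <= k * #|S|)%N ->
  (forall g : 'I_m -> 'I_n.+1, exists x, forall i, x - g i \notin S) ->
  m.+1%:R / k%:R <= covering_complexity rho.
Proof.
move=> k0 kS hard.
have S0 : (0 < #|S|)%N by case: #|S| kS => //; rewrite muln0.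
have U0 : coordinate_subspace S != 0%VS.
  by rewrite -dimv_eq0 dim_coordinate_subspace -lt0n.
have rhoP := @monomial_representation R n.
have irr := @monomial_irreducible R n.
have ub := (covering_complexityP rhoP irr).2.
apply: le_trans (ub (covering_ratio rho (coordinate_subspace S)) _); last first.
  by exists (coordinate_subspace S).
have diam : (m < additive_diam rho (coordinate_subspace S))%N.
  have [[h full] _] := additive_diamP rhoP irr U0.
  rewrite ltnNge; apply/negP => le_m.
  (* The family h may have fewer than m members; it is padded with the zero
     shift. *)
  pose g (i : 'I_m) := if insub (val i) is Some j then (h j).2 else 0.
  have [x xS] := hard g.
  suff /eqP : (\sum_i (rho (h i) @: coordinate_subspace S))%VS != fullv by [].
  apply: (coordinate_translates_proper (x := x)) => i.
  have := xS (widen_ord le_m i); rewrite /g /= insubT//= => ltn.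
  by rewrite (_ : Sub _ _ = i)//; apply: val_inj.
rewrite /covering_ratio dim_coordinate_subspace.
have -> : \dim {:V} = n.+1 by rewrite dimvf dim_matrix mul1r.
set c := Num.ceil _.
have kR : 0 < k%:R :> R by rewrite ltr0n.
have SR : 0 < #|S|%:R :> R by rewrite ltr0n.
have c0 : 0 < c by rewrite ceil_gt0 divr_gt0.
have ck : c%:~R <= k%:R :> R.
  rewrite -[k%:R]/((k%:Z)%:~R) ler_int ceil_le_int.
  by rewrite ler_pdivrMr// -natrM ler_nat.
have cR : 0 < c%:~R :> R by rewrite ltr0z.
apply: ler_pM; rewrite ?invr_ge0 ?ler0n ?ler_nat//.
by rewrite lef_pV2.
Qed.

End CoordinateSubspace.

(** * The limit superior *)

Local Open Scope ereal_scope.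

Lemma limn_esup_eq (R : realType) (u : nat -> \bar R) (l : R) :
  (forall e : R, (0 < e)%R ->
     exists n0, forall n, (n0 <= n)%N -> u n <= (l + e)%:E) ->
  (forall e : R, (0 < e)%R -> forall n0,
     exists2 n, (n0 <= n)%N & (l - e)%:E <= u n) ->
  limn_esup u = l%:E.
Proof.
move=> ub lb; rewrite /limn_esup limf_esupE; apply/eqP; rewrite eq_le; apply/andP; split.
  apply/lee_addgt0Pr => e e0; have [n0 un0] := ub e e0.
  apply: le_trans (_ : ereal_sup (u @` [set n | (n0 <= n)%N]) <= _).
    apply: ereal_inf_lbound; exists [set n | (n0 <= n)%N] => //.
    exact: nbhs_infty_ge.
  by apply: ge_ereal_sup => _ [n n0n <-]; apply: un0.
apply: le_ereal_inf_tmp => _ [A [n0 _ nA] <-].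
apply/lee_addgt0Pr => e e0; have [n n0n un] := lb e e0 n0.
rewrite -leeBlDr//; apply: le_trans un _.
by apply: ereal_sup_ubound; exists n => //; apply: nA.
Qed.

Local Close Scope ereal_scope.

Theorem theorem3 (R : realType) :
  limn_esup (fun N : nat =>
    ereal_sup [set x : \bar R |
      exists (G : compactGroupType) (V : vectType R[i])
             (dot : {dot V for Num.conj}) (rho : G -> 'End(V)),
        [/\ unitary_representation dot rho,
            irreducible rho,
            \dim {:V} = N &
            x = (covering_complexity rho / ln (N%:R : R))%:E]]) = 1%E.
Proof.
apply: limn_esup_eq => e e0.
  exists (Num.truncn (expR e^-1)).+1 => N leN.
  have eN : expR e^-1 <= N%:R.
    by apply: le_trans (ltW (truncnS_gt _)) _; rewrite ler_nat.
  have NR : 0 < N%:R :> R by apply: lt_le_trans eN; apply: expR_gt0.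
  have lnN : e^-1 <= ln N%:R by rewrite -ler_expR lnK.
  have lnN0 : 0 < ln (N%:R : R) by apply: lt_le_trans lnN; rewrite invr_gt0.
  apply: ge_ereal_sup => _ [G [V [dot [rho [[rhoP rhoU _] irr VN ->]]]]].
  rewrite lee_fin ler_pdivrMr//.
  apply: le_trans (covering_complexity_le rhoP irr rhoU) _.
  rewrite VN mulrDl mul1r lerD2l.
  by rewrite mulrC -ler_pdivrMr// div1r.
move=> n0; have [k [m [n [L [k0 m0 [Ln n0n n1 small le]]]]]] := hard_parameters n0 e0.
case: n => // n in Ln n0n n1 small le *.
exists n.+1 => //.
have [||S [kS hard]] := @hard_set_exists 'I_n.+1 R k m L k0 m0; rewrite ?card_ord//.
rewrite card_ord in kS.
have lnN0 : 0 < ln (n.+1%:R : R) by rewrite ln_gt0// ltr1n.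
apply: le_trans (_ : (covering_complexity (@monomial_rep R n) / ln n.+1%:R)%:E <= _)%E.
  rewrite lee_fin ler_pdivlMr//; apply: le_trans le _.
  exact: (monomial_complexity_ge k0 kS hard).
apply: ereal_sup_ubound.
exists (signed_shift n), 'rV[R[i]]_n.+1, (@dotmx R[i] n.+1), (@monomial_rep R n); split=> //.
- exact: monomial_unitary.
- exact: monomial_irreducible.
by rewrite dimvf dim_matrix mul1r.
Qed.
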